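(* For every $w\in\mathbb{C}$, $x>0$ and $y\in\mathbb{R}$ such that $|y|<x$, the following holds: $$\sum_{k=0}^{+\infty}\frac{1}{2^kk!(k+1/2)}\Big(\sum_{j=0}^k\frac{(2k+1)!}{2^jj!(2(k-j)+1)!}|y|^j|w|^{2(k-j)+1}\Big)\frac{1}{x^{k+1/2}}<+\infty,$$ and $$\sum_{k=0}^{+\infty}(-1)^k\frac{1}{2^kk!(k+1/2)}\frac{w^{2k+1}}{(x-y)^{k+1/2}}=\sum_{k=0}^{+\infty}(-1)^k\frac{1}{2^kk!(k+1/2)}\Big(\sum_{j=0}^k(-1)^j\frac{(2k+1)!}{2^jj!(2(k-j)+1)!}y^jw^{2(k-j)+1}\Big)\frac{1}{x^{k+1/2}}$$ $$=\sum_{k=0}^{+\infty}(-1)^k\frac{1}{2^kk!(k+1/2)}Q_{2k+1}(w,y)\frac{1}{x^{k+1/2}}.$$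
   Context: $Q_n(x,u)=\sum_{0\le k\le\lfloor n/2\rfloor}(-1)^k\frac{n!}{2^kk!(n-2k)!}x^{n-2k}u^k$ is the two-variable homogenized Hermite polynomial. *)

(* Defs.v *)
From Stdlib Require Import Reals Factorial.
From Coquelicot Require Import Coquelicot.

Definition hermite_Q (n : nat) (x u : C) : C :=
  sum_n (fun k : nat =>
    (RtoC ((-1) ^ k)%R
     * RtoC (INR (fact n) / (2 ^ k * INR (fact k) * INR (fact (n - 2 * k))))%R
     * Cpow x (n - 2 * k) * Cpow u k)%C) (Nat.div2 n).

(* Rpower is the usual real power only for 0 < x. *)
Definition half_int_pow (x : R) (k : nat) : R := Rpower x (INR k + 1 / 2).

Definition outer_coeff (k : nat) : R :=
  (1 / (2 ^ k * INR (fact k) * (INR k + 1 / 2)))%R.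

(* Used for j <= k only, so the truncated subtraction is exact. *)
Definition inner_coeff (k j : nat) : R :=
  (INR (fact (2 * k + 1)) /
     (2 ^ j * INR (fact j) * INR (fact (2 * (k - j) + 1))))%R.

(* Main.v *)
(** With [m = k - j] the double sum has terms
    (-1)^m w^(2m+1) y^j times a positive coefficient. For fixed [m], the sum over [j]
    is the binomial series of (1 - y/x)^(-(m+1/2)), up to the factor
    outer_coeff m / x^(m+1/2); this turns x into x - y. Replacing y by |y| and w by |w|
    shows that the double series converges absolutely, so it may be
    summed along the diagonals k = m + j. *)

Require Import Defs.
From Stdlib Require Import Reals Factorial Lra Lia.
From Coquelicot Require Import Coquelicot.

(** * Finite sums over a triangle, in abelian monoids and groups *)

Lemma sum_n_rev {G : AbelianMonoid} (u : nat -> G) (n : nat) :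
  sum_n (fun k => u (n - k)%nat) n = sum_n u n.
Proof.
  induction n as [|n IH].
  - now rewrite !sum_O.
  - rewrite (sum_Sn u), <- IH.
    (* The index [0] is split off at the bottom, since there the reversed sum carries [u (S n)]. *)
    unfold sum_n at 1. rewrite sum_Sn_m by lia. rewrite <- sum_n_m_S.
    rewrite plus_comm. f_equal.
Qed.

(** Induction on the size: the new diagonal [k = S n] adds one entry to each row [m <= n] and opens
    row [S n] with a single entry. *)
Lemma sum_n_triangle {G : AbelianMonoid} (u : nat -> nat -> G) (n : nat) :
  sum_n (fun k => sum_n (fun j => u (k - j)%nat j) k) n
  = sum_n (fun m => sum_n (u m) (n - m)) n.
Proof.
  induction n as [|n IH].
  - now rewrite !sum_O.
  - rewrite sum_Sn, IH, (sum_Sn (fun m => sum_n (u m) (S n - m))), Nat.sub_diag, sum_O.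
    rewrite (sum_n_ext_loc (fun m => sum_n (u m) (S n - m))
      (fun m => plus (sum_n (u m) (n - m)) (u m (S n - m)%nat))).
    2: { intros m Hm. rewrite Nat.sub_succ_l by lia. apply sum_Sn. }
    rewrite sum_n_plus, <- plus_assoc. f_equal.
    (* The new diagonal is reversed so that it is indexed by rows instead of columns. *)
    rewrite <- (sum_n_rev (fun j => u (S n - j)%nat j)), sum_Sn, !Nat.sub_diag, Nat.sub_0_r.
    f_equal. apply sum_n_ext_loc. intros m Hm. f_equal. lia.
Qed.

(* Coquelicot's canonical structures hide the carrier type from [ring]. *)
Ltac ring_in T :=
  match goal with |- ?l = ?r => change (@eq T l r) end; unfold mult; simpl; ring.

Lemma plus_minus_cancel {G : AbelianGroup} (x y : G) : plus (minus x y) y = x.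
Proof. unfold minus. now rewrite <- plus_assoc, plus_opp_l, plus_zero_r. Qed.

Lemma minus_minus_l {G : AbelianGroup} (x y z : G) :
  minus y z = plus (minus x z) (opp (minus x y)).
Proof.
  rewrite opp_minus, plus_comm. unfold minus.
  now rewrite <- plus_assoc, (plus_assoc (opp x)), plus_opp_l, plus_zero_l.
Qed.

Lemma sum_n_minus {G : AbelianGroup} (u v : nat -> G) (n : nat) :
  minus (sum_n u n) (sum_n v n) = sum_n (fun k => minus (u k) (v k)) n.
Proof.
  unfold minus. induction n as [|n IH].
  - now rewrite !sum_O.
  - rewrite !sum_Sn, <- IH, opp_plus, <- !plus_assoc. f_equal.
    rewrite !plus_assoc. f_equal. apply plus_comm.
Qed.

Local Open Scope R_scope.

(** * Diagonal summation of nonnegative double series *)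

Lemma sum_n_le_loc (a b : nat -> R) (n : nat) :
  (forall k, (k <= n)%nat -> a k <= b k) -> sum_n a n <= sum_n b n.
Proof.
  intros H. rewrite !sum_n_Reals. apply sum_Rle. intros k Hk. now apply H.
Qed.

Lemma sum_n_nonneg_le (a : nat -> R) (n p : nat) :
  (forall k, 0 <= a k) -> (n <= p)%nat -> sum_n a n <= sum_n a p.
Proof.
  intros Ha Hnp. induction Hnp as [|p Hnp IH]; [lra|].
  rewrite sum_Sn. unfold plus; simpl. specialize (Ha (S p)). lra.
Qed.

Lemma sum_n_le_is_series (a : nat -> R) (l : R) (n : nat) :
  (forall k, 0 <= a k) -> is_series a l -> sum_n a n <= l.
Proof.
  intros Ha Hl. apply (is_lim_seq_incr_compare (sum_n a) l Hl).
  intros k. apply sum_n_nonneg_le; auto.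
Qed.

Lemma is_lim_seq_sum_n (u : nat -> nat -> R) (l : nat -> R) (n : nat) :
  (forall m, is_lim_seq (u m) (l m)) ->
  is_lim_seq (fun p => sum_n (fun m => u m p) n) (sum_n l n).
Proof.
  intros H. induction n as [|n IH].
  - rewrite sum_O. apply is_lim_seq_ext with (u O); [|apply H].
    intros p. now rewrite sum_O.
  - rewrite sum_Sn.
    apply is_lim_seq_ext with (fun p => sum_n (fun m => u m p) n + u (S n) p).
    + intros p. now rewrite sum_Sn.
    + now apply is_lim_seq_plus'.
Qed.

(** The triangular sums increase and are bounded by [S], hence converge to some [L <= S]. For
    [S <= L], finite rectangles are enclosed in triangles, letting first the number of columns and
    then the number of rows grow. *)
Lemma is_series_triangle_nonneg (a : nat -> nat -> R) (s : nat -> R) (S : R) :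
  (forall m j, 0 <= a m j) -> (forall m, is_series (a m) (s m)) ->
  is_series s S ->
  is_series (fun k => sum_n (fun j => a (k - j)%nat j) k) S.
Proof.
  intros Ha Hs HS.
  set (D := sum_n (fun k => sum_n (fun j => a (k - j)%nat j) k)).
  assert (Hs0 : forall m, 0 <= s m).
  { intros m. apply Rle_trans with (sum_n (a m) 0).
    - rewrite sum_O. apply Ha.
    - now apply sum_n_le_is_series. }
  assert (Hup : forall n, D n <= S).
  { intros n. unfold D. rewrite sum_n_triangle.
    apply Rle_trans with (sum_n s n).
    - apply sum_n_le_loc. intros m _. now apply sum_n_le_is_series.
    - now apply sum_n_le_is_series. }
  assert (Hinc : forall n, D n <= D (Datatypes.S n)).
  { intros n. apply sum_n_nonneg_le; [|lia]. intros k.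
    apply Rle_trans with (sum_n (fun j => a (k - j)%nat j) 0).
    - rewrite sum_O. apply Ha.
    - apply sum_n_nonneg_le; [|lia]. intros j; apply Ha. }
  destruct (ex_finite_lim_seq_incr D S Hinc Hup) as [L HL].
  assert (HD : forall n, D n <= L) by (now apply is_lim_seq_incr_compare).
  assert (HLS : L <= S).
  { apply (is_lim_seq_le D (fun _ => S) L S Hup HL). apply is_lim_seq_const. }
  assert (HSL : S <= L).
  { apply (is_lim_seq_le (sum_n s) (fun _ => L) S L); [|exact HS|apply is_lim_seq_const].
    intros M.
    apply (is_lim_seq_le (fun p => sum_n (fun m => sum_n (a m) p) M) (fun _ => L)
             (sum_n s M) L); [| |apply is_lim_seq_const].
    (* The rows [m <= M] cut at column [p] lie in the triangle of size [M + p], because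
       [p <= M + p - m]. *)
    - intros p. apply Rle_trans with (D (M + p)%nat); [|apply HD].
      unfold D. rewrite sum_n_triangle.
      apply Rle_trans with (sum_n (fun m => sum_n (a m) (M + p - m)) M).
      + apply sum_n_le_loc. intros m Hm. apply sum_n_nonneg_le; [apply Ha|lia].
      + apply sum_n_nonneg_le; [|lia]. intros m.
        apply Rle_trans with (sum_n (a m) 0).
        * rewrite sum_O. apply Ha.
        * apply sum_n_nonneg_le; [apply Ha|lia].
    - apply is_lim_seq_sum_n. exact Hs. }
  replace S with L by lra. exact HL.
Qed.

(** * Diagonal summation of dominated double series in normed modules *)

Lemma norm_sum_n_le {K : AbsRing} {V : NormedModule K}
    (a : nat -> V) (b : nat -> R) (n : nat) :
  (forall k, norm (a k) <= b k) -> norm (sum_n a n) <= sum_n b n.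
Proof.
  intros H. apply Rle_trans with (sum_n (fun k => norm (a k)) n).
  - apply norm_sum_n_m.
  - apply sum_n_le_loc. auto.
Qed.

Lemma norm_is_series_le {K : AbsRing} {V : NormedModule K}
    (a : nat -> V) (b : nat -> R) (l : V) (L : R) :
  (forall k, norm (a k) <= b k) -> is_series a l -> is_series b L -> norm l <= L.
Proof.
  intros H Ha Hb.
  apply (is_lim_seq_le (fun n => norm (sum_n a n)) (sum_n b) (norm l) L); [| |exact Hb].
  - intros n. now apply norm_sum_n_le.
  - apply (filterlim_comp _ _ _ _ _ _ _ _ Ha (filterlim_norm l)).
Qed.

Lemma norm_series_tail_le {K : AbsRing} {V : NormedModule K}
    (a : nat -> V) (b : nat -> R) (l : V) (L : R) (n : nat) :
  (forall k, norm (a k) <= b k) -> is_series a l -> is_series b L ->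
  norm (minus l (sum_n a n)) <= L - sum_n b n.
Proof.
  intros H Ha Hb.
  (* The tail is a dominated series in its own right. It starts at [S n] because [sum_n a n]
     includes the index [n]. *)
  apply (norm_is_series_le (fun k => a (S n + k)%nat) (fun k => b (S n + k)%nat)).
  - auto.
  - apply is_series_incr_n; [lia|]. simpl pred.
    refine (eq_ind l (is_series a) Ha _ _). symmetry. apply (plus_minus_cancel (G := V)).
  - apply is_series_incr_n; [lia|]. simpl pred.
    refine (eq_ind L (is_series b) Hb _ _).
    change (L = L - sum_n b n + sum_n b n). ring.
Qed.

(** The partial row sum [sum_n d n] differs from the triangular sum of [c] by the row tails outside
    the triangle. These are dominated by the same tails of [a], whose total is the difference of two
    sequences that both tend to [S]. *)
Lemma is_series_triangle {K : AbsRing} {V : NormedModule K}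
    (c : nat -> nat -> V) (a : nat -> nat -> R)
    (d : nat -> V) (s : nat -> R) (T : V) (S : R) :
  (forall m j, norm (c m j) <= a m j) ->
  (forall m, is_series (a m) (s m)) -> is_series s S ->
  (forall m, is_series (c m) (d m)) -> is_series d T ->
  is_series (fun k => sum_n (fun j => c (k - j)%nat j) k) T.
Proof.
  intros Hca Ha HS Hc HT.
  assert (Ha0 : forall m j, 0 <= a m j).
  { intros m j. apply Rle_trans with (2 := Hca m j). apply norm_ge_0. }
  pose proof (is_series_triangle_nonneg a s S Ha0 Ha HS) as HD.
  pose proof (is_lim_seq_minus' _ _ _ _ HS HD) as Hlim.
  rewrite Rminus_diag in Hlim.
  apply is_lim_seq_spec in Hlim.
  apply filterlim_locally_ball_norm. intros eps.
  assert (He : 0 < eps / 2) by (destruct eps; simpl; lra).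
  specialize (Hlim (mkposreal _ He)).
  pose proof (proj1 (filterlim_locally_ball_norm _ _) HT (mkposreal _ He)) as HT'.
  generalize (filter_and _ _ Hlim HT'). apply filter_imp.
  clear Hlim HT'. intros n [H1 H2]. simpl in H1.
  unfold ball_norm in *; simpl in H2 |- *.
  set (E := sum_n (fun k => sum_n (fun j => c (k - j)%nat j) k) n).
  assert (H3 : norm (minus (sum_n d n) E) <= sum_n s n -
      sum_n (fun k => sum_n (fun j => a (k - j)%nat j) k) n).
  { unfold E. rewrite !sum_n_triangle.
    etransitivity; [apply Req_le, f_equal, (sum_n_minus (G := V) d)|].
    etransitivity; [|apply Req_le; symmetry; apply (sum_n_minus (G := R_AbelianGroup) s)].
    apply norm_sum_n_le. intros m. now apply norm_series_tail_le. }
  rewrite Rminus_0_r in H1.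
  apply Rabs_def2, proj1 in H1.
  (* The error splits at [sum_n d n]: one half of [eps] pays for the row tails, the other for the
     convergence of [d] to [T]. *)
  assert (HE : minus E T = plus (minus (sum_n d n) T) (opp (minus (sum_n d n) E)))
    by apply (minus_minus_l (G := V)).
  rewrite HE.
  apply Rle_lt_trans with (1 := norm_triangle _ _). rewrite norm_opp.
  replace (pos eps) with (eps / 2 + eps / 2) by field.
  apply Rplus_lt_compat; [exact H2|].
  apply Rle_lt_trans with (1 := H3). exact H1.
Qed.

(** * The binomial series with negative exponent *)

(* Taylor coefficients of (1 - z)^(-alpha). *)
Fixpoint rising_coeff (alpha : R) (j : nat) : R :=
  match j with
  | O => 1
  | S i => rising_coeff alpha i * ((alpha + INR i) / (INR i + 1))
  end.

Lemma rising_coeff_pos (alpha : R) (j : nat) : 0 < alpha -> 0 < rising_coeff alpha j.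
Proof.
  intros Ha. induction j as [|j IH]; simpl; [lra|].
  pose proof (pos_INR j).
  apply Rmult_lt_0_compat; [exact IH|]. apply Rdiv_lt_0_compat; lra.
Qed.

(** Ratio test: consecutive coefficients have quotient [(alpha + n) / (n + 1) = 1 + (alpha - 1) / (n
    + 1)], which tends to 1. *)
Lemma CV_radius_rising_coeff (alpha : R) : 0 < alpha -> CV_radius (rising_coeff alpha) = 1.
Proof.
  intros Ha. replace (Finite 1) with (Finite (/ 1)) by (f_equal; field).
  apply CV_radius_finite_DAlembert; [|lra|].
  - intros n. pose proof (rising_coeff_pos alpha n Ha). lra.
  - apply is_lim_seq_ext with (fun n => 1 + (alpha - 1) * / INR (S n)).
    + intros n. pose proof (rising_coeff_pos alpha n Ha). pose proof (pos_INR n).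
      simpl rising_coeff.
      replace (_ / _) with ((alpha + INR n) / (INR n + 1)) by (field; lra).
      rewrite Rabs_pos_eq by (apply Rlt_le, Rdiv_lt_0_compat; lra).
      rewrite S_INR. field. lra.
    + replace (Finite 1) with (Finite (1 + (alpha - 1) * 0)) by (f_equal; ring).
      apply is_lim_seq_plus'; [apply is_lim_seq_const|].
      change (Finite ((alpha - 1) * 0)) with (Rbar_mult (alpha - 1) 0).
      apply is_lim_seq_scal_l.
      apply (is_lim_seq_incr_1 (fun n => / INR n)).
      replace (Finite 0) with (Rbar_inv p_infty) by reflexivity.
      apply is_lim_seq_inv; [apply is_lim_seq_INR|discriminate].
Qed.

(** Coefficientwise this is the recurrence [(n + 1) * b (n + 1) - n * b n = alpha * b n]. It is the
    differential equation of [(1 - z)^(-alpha)]. *)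
Lemma PSeries_rising_coeff_ode (alpha z : R) :
  0 < alpha -> Rabs z < 1 ->
  (1 - z) * PSeries (PS_derive (rising_coeff alpha)) z
  = alpha * PSeries (rising_coeff alpha) z.
Proof.
  intros Ha Hz.
  set (b := rising_coeff alpha).
  assert (Hr : Rbar_lt (Rabs z) (CV_radius b))
    by (unfold b; now rewrite CV_radius_rising_coeff).
  assert (Hex : ex_pseries (PS_derive b) z) by now apply ex_pseries_derive.
  assert (Hex' : ex_pseries b z) by now apply CV_radius_inside.
  rewrite Rmult_minus_distr_r, Rmult_1_l, <- PSeries_incr_1.
  rewrite <- PSeries_scal, <- PSeries_minus; [|exact Hex|now apply ex_pseries_incr_1].
  apply PSeries_ext. intros [|n].
  (* Multiplication by [z] shifts the coefficients and puts 0 in front, so the constant term is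
     treated apart. *)
  - change (1 * (1 * ((alpha + 0) / (0 + 1))) + - 0 = alpha * 1). field.
  - set (t := INR (S n)). set (q := b (S n)).
    change (INR (S (S n)) * (q * ((alpha + t) / (t + 1))) + - (t * q) = alpha * q).
    rewrite S_INR. fold t.
    assert (0 <= t) by apply pos_INR. field. lra.
Qed.

Lemma eq_is_derive_sym (f : R -> R) (z : R) :
  (forall t, Rabs t <= Rabs z -> is_derive f t 0) -> f z = f 0.
Proof.
  intros H. destruct (Rtotal_order z 0) as [Hz|[->|Hz]]; [|reflexivity|symmetry].
  all: apply eq_is_derive; [|exact Hz]; intros t Ht; apply H.
  - rewrite !Rabs_left1; lra.
  - rewrite !Rabs_pos_eq; lra.
Qed.

(** By the differential equation, the product of the power series with [(1 - t)^alpha] has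
    derivative zero, so it keeps its value 1 at the origin. *)
Lemma is_series_Rpower_neg (alpha z : R) :
  0 < alpha -> Rabs z < 1 ->
  is_series (fun j => rising_coeff alpha j * z ^ j) (/ Rpower (1 - z) alpha).
Proof.
  intros Ha Hz.
  assert (Hr : forall t, Rabs t < 1 -> Rbar_lt (Rabs t) (CV_radius (rising_coeff alpha)))
    by (intros t Ht; now rewrite CV_radius_rising_coeff).
  apply is_pseries_R.
  assert (Heq : PSeries (rising_coeff alpha) z * Rpower (1 - z) alpha = 1).
  { rewrite (eq_is_derive_sym (fun t => PSeries (rising_coeff alpha) t * Rpower (1 - t) alpha)).
    - rewrite PSeries_0. simpl. unfold Rpower. rewrite Rminus_0_r, ln_1, Rmult_0_r, exp_0. ring.
    - intros t Ht. assert (Ht1 : Rabs t < 1) by lra.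
      assert (Hpos : 0 < 1 - t) by (apply Rabs_def2 in Ht1; lra).
      pose proof (is_derive_PSeries (rising_coeff alpha) t (Hr t Ht1)) as HP.
      pose proof (PSeries_rising_coeff_ode alpha t Ha Ht1) as Hode.
      assert (HR : is_derive (fun t => Rpower (1 - t) alpha) t
                (- alpha / (1 - t) * Rpower (1 - t) alpha)).
      { unfold Rpower. auto_derive; [exact Hpos|]. fold (1 - t). field. lra. }
      pose proof (is_derive_mult _ _ _ _ _ HP HR Rmult_comm) as HM.
      replace 0 with (plus (mult (PSeries (PS_derive (rising_coeff alpha)) t) (Rpower (1 - t) alpha))
        (mult (PSeries (rising_coeff alpha) t) (- alpha / (1 - t) * Rpower (1 - t) alpha))); [exact HM|].
      unfold plus, mult; simpl.
      replace (PSeries (PS_derive (rising_coeff alpha)) t)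
        with (alpha * PSeries (rising_coeff alpha) t / (1 - t)); [field; lra|].
      rewrite <- Hode. field. lra. }
  replace (/ Rpower (1 - z) alpha) with (PSeries (rising_coeff alpha) z).
  - apply PSeries_correct, CV_radius_inside, Hr, Hz.
  - assert (0 < Rpower (1 - z) alpha) by apply exp_pos.
    apply Rmult_eq_reg_r with (Rpower (1 - z) alpha); [|lra].
    rewrite Heq. field. lra.
Qed.

(** * The coefficients of the double series and its row sums *)

Lemma outer_coeff_pos (k : nat) : 0 < outer_coeff k.
Proof.
  unfold outer_coeff. pose proof (pos_INR k). pose proof (INR_fact_lt_0 k).
  pose proof (pow_lt 2 k ltac:(lra)).
  apply Rdiv_lt_0_compat; [lra|]. repeat apply Rmult_lt_0_compat; lra.
Qed.

Lemma outer_coeff_le (k : nat) : outer_coeff k <= 2 / INR (fact k).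
Proof.
  unfold outer_coeff. pose proof (pos_INR k). pose proof (INR_fact_lt_0 k).
  assert (1 <= 2 ^ k) by (apply pow_R1_Rle; lra).
  assert (0 < 2 ^ k * INR (fact k) * (INR k + 1 / 2))
    by (repeat apply Rmult_lt_0_compat; lra).
  apply Rmult_le_reg_r with (2 ^ k * INR (fact k) * (INR k + 1 / 2)); [lra|].
  replace (1 / _ * _) with 1 by (field; repeat split; lra).
  replace (2 / _ * _) with (2 ^ k * (2 * INR k + 1)) by (field; lra).
  nra.
Qed.

Lemma half_int_pow_pos (x : R) (k : nat) : 0 < half_int_pow x k.
Proof. apply exp_pos. Qed.

Lemma half_int_pow_eq (x : R) (k : nat) :
  0 < x -> half_int_pow x k = x ^ k * Rpower x (1 / 2).
Proof.
  intros Hx. unfold half_int_pow. now rewrite Rpower_plus, Rpower_pow.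
Qed.

(** When [j] grows by one, the factorials on the left cancel down to the ratio
    [(m + j + 1/2) / (j + 1)], exactly the step of [rising_coeff]. This is what turns each row into
    a binomial series. *)
Lemma outer_inner_coeff (m j : nat) :
  outer_coeff (m + j) * inner_coeff (m + j) j
  = outer_coeff m * rising_coeff (INR m + 1 / 2) j.
Proof.
  induction j as [|j IH].
  - unfold inner_coeff. rewrite Nat.add_0_r, Nat.sub_0_r. simpl rising_coeff.
    simpl fact at 2. simpl pow. pose proof (INR_fact_lt_0 (2 * m + 1)).
    change (INR 1) with 1. field. lra.
  - simpl rising_coeff. rewrite <- Rmult_assoc, <- IH.
    unfold inner_coeff, outer_coeff.
    replace (m + S j - S j)%nat with m by lia.
    replace (m + j - j)%nat with m by lia.
    replace (2 * (m + S j) + 1)%nat with (S (S (2 * (m + j) + 1))) by lia.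
    replace (m + S j)%nat with (S (m + j)) by lia.
    pose proof (INR_fact_lt_0 (2 * m + 1)).
    pose proof (INR_fact_lt_0 (m + j)). pose proof (INR_fact_lt_0 j).
    pose proof (INR_fact_lt_0 (2 * (m + j) + 1)).
    rewrite (fact_simpl (m + j)), (fact_simpl j), (fact_simpl (S (2 * (m + j) + 1))),
      (fact_simpl (2 * (m + j) + 1)), !mult_INR, !S_INR.
    rewrite !(plus_INR (2 * (m + j))), mult_INR, !plus_INR. simpl (INR 1). simpl (INR 2).
    rewrite <- !tech_pow_Rmult.
    pose proof (pos_INR m). pose proof (pos_INR j).
    pose proof (pow_lt 2 j ltac:(lra)). pose proof (pow_lt 2 (m + j) ltac:(lra)).
    field. repeat split; lra.
Qed.

(** Up to sign, the coefficient of [y^j * w^(2m+1)] in the expansion; row [m] fixes the power of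
    [w], and the entry comes from the diagonal [k = m + j]. *)
Definition double_coeff (x : R) (m j : nat) : R :=
  outer_coeff (m + j) * inner_coeff (m + j) j * (1 / half_int_pow x (m + j)).

Lemma double_coeff_eq (x : R) (m j : nat) : 0 < x ->
  double_coeff x m j
  = outer_coeff m / half_int_pow x m * (rising_coeff (INR m + 1 / 2) j * (/ x) ^ j).
Proof.
  intros Hx. unfold double_coeff.
  rewrite outer_inner_coeff, !half_int_pow_eq, pow_add, pow_inv by exact Hx.
  assert (0 < Rpower x (1 / 2)) by apply exp_pos.
  pose proof (pow_lt x m Hx). pose proof (pow_lt x j Hx).
  field. repeat split; lra.
Qed.

Lemma double_coeff_nonneg (x : R) (m j : nat) : 0 < x -> 0 <= double_coeff x m j.
Proof.
  intros Hx. rewrite double_coeff_eq by exact Hx.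
  pose proof (outer_coeff_pos m). pose proof (half_int_pow_pos x m).
  pose proof (pos_INR m).
  pose proof (rising_coeff_pos (INR m + 1 / 2) j ltac:(lra)).
  pose proof (pow_lt (/ x) j (Rinv_0_lt_compat x Hx)).
  apply Rlt_le, Rmult_lt_0_compat;
    [now apply Rdiv_lt_0_compat|now apply Rmult_lt_0_compat].
Qed.

Lemma is_series_double_coeff (x y : R) (m : nat) :
  0 < x -> Rabs y < x ->
  is_series (fun j => double_coeff x m j * y ^ j) (outer_coeff m / half_int_pow (x - y) m).
Proof.
  intros Hx Hy. set (alpha := INR m + 1 / 2).
  assert (Ha : 0 < alpha) by (unfold alpha; pose proof (pos_INR m); lra).
  assert (Hz : Rabs (y / x) < 1).
  { unfold Rdiv. rewrite Rabs_mult, Rabs_inv, (Rabs_pos_eq x) by lra.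
    apply Rmult_lt_reg_r with x; [lra|]. field_simplify; lra. }
  pose proof (is_series_Rpower_neg alpha (y / x) Ha Hz) as H.
  apply (is_series_scal_l (outer_coeff m / half_int_pow x m)) in H.
  (* From [x - y = x * (1 - y / x)]; [Rpower] is multiplicative here because both factors are
     positive. *)
  assert (Hxy : half_int_pow (x - y) m = half_int_pow x m * Rpower (1 - y / x) alpha).
  { unfold half_int_pow. fold alpha. rewrite Rpower_mult_distr.
    - f_equal. field. lra.
    - exact Hx.
    - apply Rabs_def2 in Hz. lra. }
  replace (outer_coeff m / half_int_pow (x - y) m)
    with (scal (outer_coeff m / half_int_pow x m) (/ Rpower (1 - y / x) alpha)).
  - revert H. apply is_series_ext. intros j.
    rewrite double_coeff_eq by exact Hx. fold alpha.
    unfold Rdiv at 2. rewrite Rpow_mult_distr.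
    unfold scal; simpl; unfold mult; simpl. ring.
  - rewrite Hxy. pose proof (half_int_pow_pos x m).
    assert (0 < Rpower (1 - y / x) alpha) by apply exp_pos.
    unfold scal; simpl; unfold mult; simpl. field. lra.
Qed.

(** Comparison with the exponential series at [r ^ 2 / x]. *)
Lemma ex_series_outer_coeff (x r : R) : 0 < x -> 0 <= r ->
  ex_series (fun m => outer_coeff m / half_int_pow x m * r ^ (2 * m + 1)).
Proof.
  intros Hx Hr.
  apply (ex_series_le (V := R_CompleteNormedModule) _ (fun m =>
    2 * r / Rpower x (1 / 2) * (/ INR (fact m) * (r ^ 2 / x) ^ m))).
  - intros m. change (Rabs (outer_coeff m / half_int_pow x m * r ^ (2 * m + 1))
      <= 2 * r / Rpower x (1 / 2) * (/ INR (fact m) * (r ^ 2 / x) ^ m)).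
    pose proof (outer_coeff_pos m). pose proof (half_int_pow_pos x m).
    pose proof (INR_fact_lt_0 m). pose proof (pow_lt x m Hx).
    assert (0 < Rpower x (1 / 2)) by apply exp_pos.
    rewrite Rabs_pos_eq.
    2:{ apply Rmult_le_pos; [|now apply pow_le]. apply Rlt_le, Rdiv_lt_0_compat; lra. }
    (* The factor common to the term and its majorant; what remains is [outer_coeff_le]. *)
    set (q := r * (r ^ 2) ^ m / (x ^ m * Rpower x (1 / 2))).
    replace (_ * r ^ (2 * m + 1)) with (outer_coeff m * q).
    2:{ unfold q. rewrite half_int_pow_eq, pow_add, pow_mult, pow_1 by exact Hx.
        field. lra. }
    replace (_ * (/ INR (fact m) * _)) with (2 / INR (fact m) * q).
    2:{ unfold q, Rdiv. rewrite Rpow_mult_distr, pow_inv. field. lra. }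
    apply Rmult_le_compat_r; [|apply outer_coeff_le].
    unfold q. apply Rmult_le_pos.
    + apply Rmult_le_pos; [exact Hr|]. apply pow_le, pow_le, Hr.
    + apply Rlt_le, Rinv_0_lt_compat, Rmult_lt_0_compat; lra.
  - apply (ex_series_scal_l (V := R_NormedModule) (2 * r / Rpower x (1 / 2))
             (fun m => / INR (fact m) * (r ^ 2 / x) ^ m)).
    exists (exp (r ^ 2 / x)). apply (is_pseries_R (fun n => / INR (fact n))), is_exp_Reals.
Qed.

(** * Passage to complex terms and to the Hermite polynomials *)

Lemma sum_n_RtoC (a : nat -> R) (n : nat) :
  sum_n (fun k => RtoC (a k)) n = RtoC (sum_n a n).
Proof.
  induction n as [|n IH].
  - now rewrite !sum_O.
  - rewrite !sum_Sn, IH. symmetry. apply RtoC_plus.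
Qed.

Lemma is_series_RtoC (a : nat -> R) (l : R) :
  is_series a l -> is_series (fun k => RtoC (a k)) (RtoC l).
Proof.
  intros H. apply filterlim_locally_ball_norm. intros eps.
  generalize (proj1 (filterlim_locally_ball_norm _ _) H eps). apply filter_imp.
  intros n Hn. unfold ball_norm in *. rewrite sum_n_RtoC.
  change (Cmod (RtoC (sum_n a n) - RtoC l) < eps).
  rewrite <- RtoC_minus, Cmod_R. exact Hn.
Qed.

Lemma hermite_Q_odd (k : nat) (w : C) (y : R) :
  hermite_Q (2 * k + 1) w (RtoC y)
  = sum_n (fun j : nat =>
      (RtoC ((-1) ^ j)%R * RtoC (inner_coeff k j)
       * RtoC (y ^ j)%R * Cpow w (2 * (k - j) + 1))%C) k.
Proof.
  unfold hermite_Q.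
  replace (Nat.div2 (2 * k + 1)) with k
    by (rewrite Nat.add_1_r, Nat.div2_succ_double; reflexivity).
  apply sum_n_ext_loc. intros j Hj. unfold inner_coeff.
  replace (2 * k + 1 - 2 * j)%nat with (2 * (k - j) + 1)%nat by lia.
  rewrite (RtoC_pow y).
  ring_in C.
Qed.

Theorem proposition5p11 :
  forall (w : C) (x y : R), (0 < x)%R -> (Rabs y < x)%R ->
  ex_series (fun k : nat =>
    (outer_coeff k
     * sum_n (fun j : nat =>
         inner_coeff k j * Rabs y ^ j * Cmod w ^ (2 * (k - j) + 1)) k
     * (1 / half_int_pow x k))%R)
  /\
  exists S : C,
    is_series (fun k : nat =>
      (RtoC ((-1) ^ k)%R * RtoC (outer_coeff k)
       * (Cpow w (2 * k + 1) / RtoC (half_int_pow (x - y)%R k)))%C) S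
    /\
    is_series (fun k : nat =>
      (RtoC ((-1) ^ k)%R * RtoC (outer_coeff k)
       * sum_n (fun j : nat =>
           (RtoC ((-1) ^ j)%R * RtoC (inner_coeff k j)
            * RtoC (y ^ j)%R * Cpow w (2 * (k - j) + 1))%C) k
       * RtoC (1 / half_int_pow x k)%R)%C) S
    /\
    is_series (fun k : nat =>
      (RtoC ((-1) ^ k)%R * RtoC (outer_coeff k)
       * hermite_Q (2 * k + 1) w (RtoC y)
       * RtoC (1 / half_int_pow x k)%R)%C) S.
Proof.
  intros w x y Hx Hy.
  assert (Hy' : Rabs (Rabs y) < x) by now rewrite Rabs_Rabsolu.
  (* The array of absolute values and its row sums: the binomial rows evaluated at [Rabs y], hence
     with [x - Rabs y > 0] in the denominator. *)
  set (a := fun m j => double_coeff x m j * Rabs y ^ j * Cmod w ^ (2 * m + 1)).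
  set (s := fun m => outer_coeff m / half_int_pow (x - Rabs y) m * Cmod w ^ (2 * m + 1)).
  assert (Ha : forall m, is_series (a m) (s m)).
  { intros m. apply is_series_scal_r. now apply is_series_double_coeff. }
  assert (Ha0 : forall m j, 0 <= a m j).
  { intros m j. apply Rmult_le_pos; [apply Rmult_le_pos|].
    - now apply double_coeff_nonneg.
    - apply pow_le, Rabs_pos.
    - apply pow_le, Cmod_ge_0. }
  assert (Hs : ex_series s) by (apply ex_series_outer_coeff; [lra|apply Cmod_ge_0]).
  destruct Hs as [S HS].
  split.
  { exists S. generalize (is_series_triangle_nonneg a s S Ha0 Ha HS).
    apply is_series_ext. intros k.
    set (q := 1 / half_int_pow x k).
    transitivity (outer_coeff k * q * sum_n (fun j : nat =>
      inner_coeff k j * Rabs y ^ j * Cmod w ^ (2 * (k - j) + 1)) k); [|ring_in R].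
    rewrite <- (sum_n_mult_l (K := R_Ring)). apply sum_n_ext_loc. intros j Hj.
    unfold a, double_coeff. rewrite Nat.sub_add by exact Hj. fold q.
    ring_in R. }
  (* On the diagonal [k = m + j] the signs [(-1)^k] and [(-1)^j] combine to [(-1)^m], so the sign
     and the power of [w] leave the row as one factor. The row sums [d] are the terms of the series
     in [x - y]. *)
  set (v := fun m => (RtoC ((-1) ^ m)%R * Cpow w (2 * m + 1))%C).
  set (c := fun m j => (v m * RtoC (double_coeff x m j * y ^ j)%R)%C).
  set (d := fun m => (v m * RtoC (outer_coeff m / half_int_pow (x - y) m)%R)%C).
  assert (Hv : forall m, Cmod (v m) = Cmod w ^ (2 * m + 1)).
  { intros m. unfold v. rewrite Cmod_mult, Cmod_pow, Cmod_R, pow_1_abs. ring. }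
  assert (Hc : forall m, is_series (c m) (d m)).
  { intros m. apply (is_series_scal_l (V := C_NormedModule) (v m)).
    now apply is_series_RtoC, is_series_double_coeff. }
  assert (Hca : forall m j, norm (c m j) <= a m j).
  { intros m j. change (Cmod (c m j) <= a m j). unfold c, a.
    rewrite Cmod_mult, Hv, Cmod_R, Rabs_mult, <- RPow_abs, (Rabs_pos_eq (double_coeff x m j))
      by now apply double_coeff_nonneg.
    apply Req_le. ring. }
  (* Each row sum is bounded in modulus by the corresponding [s m], and completeness of the complex
     numbers gives a limit. *)
  assert (Hd : ex_series d).
  { apply (ex_series_le (V := C_CompleteNormedModule) d s); [|now exists S].
    intros m. now apply (norm_is_series_le (V := C_NormedModule) (c m) (a m)). }
  destruct Hd as [T HT].
  exists T.
  pose proof (is_series_triangle c a d s T S Hca Ha HS Hc HT) as HD.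
  assert (H2 : is_series (fun k : nat =>
      (RtoC ((-1) ^ k)%R * RtoC (outer_coeff k)
       * sum_n (fun j : nat =>
           (RtoC ((-1) ^ j)%R * RtoC (inner_coeff k j)
            * RtoC (y ^ j)%R * Cpow w (2 * (k - j) + 1))%C) k
       * RtoC (1 / half_int_pow x k)%R)%C) T).
  { revert HD. apply is_series_ext. intros k.
    set (q := 1 / half_int_pow x k).
    transitivity (RtoC ((-1) ^ k) * RtoC (outer_coeff k) * RtoC q * sum_n (fun j : nat =>
      RtoC ((-1) ^ j) * RtoC (inner_coeff k j) * RtoC (y ^ j) * Cpow w (2 * (k - j) + 1)) k)%C;
      [|ring_in C].
    rewrite <- (sum_n_mult_l (K := C_Ring)). apply sum_n_ext_loc. intros j Hj.
    unfold c, v, double_coeff. rewrite Nat.sub_add by exact Hj. fold q.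
    replace ((-1) ^ (k - j)) with ((-1) ^ k * (-1) ^ j).
    - rewrite !RtoC_mult. ring_in C.
    (* After this the sign [(-1)^j] occurs twice, and the two copies multiply to 1. *)
    - replace k with (k - j + j)%nat at 1 by lia.
      rewrite pow_add, Rmult_assoc, <- Rpow_mult_distr.
      replace (-1 * -1) with 1 by ring. now rewrite pow1, Rmult_1_r. }
  split; [|split].
  - revert HT. apply is_series_ext. intros m. unfold d, v.
    pose proof (half_int_pow_pos (x - y) m).
    rewrite RtoC_div by lra. unfold Cdiv. ring_in C.
  - exact H2.
  - revert H2. apply is_series_ext. intros k. now rewrite hermite_Q_odd.
Qed.
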